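(* Let $\mathbb{H}$ be a complex Hilbert space and let $T\in B(\mathbb{H})$ be non-zero. Then the following inequalities hold: $$w(T)\geq \frac{\|T\|}{2}+\frac{m(T^2)}{2\|T\|},$$ $$w(T)\geq \frac{c^2(T)}{2\|T\|}+\frac{w(T^2)}{2\|T\|}.$$
   Context: $B(\mathbb{H})$ denotes the bounded linear operators on the complex Hilbert space $\mathbb{H}$, and $\|T\|$ is the operator norm. The numerical radius is $w(T)=\sup\{|\langle Tx,x\rangle| : x\in\mathbb{H}, \|x\|=1\}$, the Crawford number is $m(T)=\inf\{|\langle Tx,x\rangle| : x\in\mathbb{H}, \|x\|=1\}$, and the minimum norm is $c(T)=\inf\{\|Tx\| : x\in\mathbb{H}, \|x\|=1\}$; $c^2(T)$ means $(c(T))^2$. *)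

(* Defs.v *)
From HB Require Import structures.
From mathcomp Require Import all_boot all_order all_algebra complex.
From mathcomp Require Import all_classical all_reals all_analysis.

Set Implicit Arguments.
Unset Strict Implicit.
Unset Printing Implicit Defensive.

Import Order.TTheory GRing.Theory Num.Theory Num.Def.
Import numFieldNormedType.Exports.

Local Open Scope classical_set_scope.
Local Open Scope ring_scope.
Local Open Scope complex_scope.

(* The inner product is linear in its first argument and conjugate-linear in
   its second one. *)
HB.mixin Record NormedModule_hasInner (R : realType) H
    of NormedModule R[i] H := {
  inner : {dot H for conjC} ;
  normr_inner : forall x : H, `|x| ^+ 2 = inner x x
}.

#[short(type="hilbertType")]
HB.structure Definition Hilbert (R : realType) :=
  {H of CompleteNormedModule R[i] H & NormedModule_hasInner R H}.

Section operators.
Context {R : realType} {H : hilbertType R}.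
Implicit Types T : H -> H.

(* The norm of a normed module over R[i] takes its values in R[i]; rnorm is the
   same number as an element of R. *)
Definition rnorm (x : H) : R := complex.Re `|x|.

Definition bounded_operator T : Prop :=
  exists M : R, forall x : H, rnorm (T x) <= M * rnorm x.

Definition opnorm T : R := sup [set rnorm (T x) | x in [set x | rnorm x = 1]].

(* complex.Re `|z| is the modulus of z : R[i], as an element of R. *)
Definition numerical_radius T : R :=
  sup [set complex.Re `|inner (T x) x| | x in [set x : H | rnorm x = 1]].

Definition crawford_number T : R :=
  inf [set complex.Re `|inner (T x) x| | x in [set x : H | rnorm x = 1]].

Definition minimum_norm T : R :=
  inf [set rnorm (T x) | x in [set x | rnorm x = 1]].

End operators.

(* Main.v *)
(** For a unit vector x put a = |Tx| and choose a unimodular c such that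
    c^2 <T^2 x, x> = |<T^2 x, x>|. Evaluating the quadratic form <Tu, u> at
    u = a x + c Tx and u = a x - c Tx, subtracting, and bounding each value by
    w(T) |u|^2 yields  a^2 + |<T^2 x, x>| <= 2 w(T) a.  Both inequalities follow
    by bounding a on the right by |T| and taking suprema over x. *)
Require Import Defs.
From mathcomp Require Import all_boot all_order all_algebra complex.
From mathcomp Require Import all_classical all_reals all_analysis.
From mathcomp Require Import ring lra.
Import Order.TTheory GRing.Theory Num.Theory Num.Def.

Local Open Scope ring_scope.

Section HilbertOperators.
Context {R : realType} {H : hilbertType R}.
Implicit Types (x y z : H) (A : H -> H) (T : {linear H -> H}).
Local Notation C := R[i]%C.

(** In [R[i]] comparable numbers have equal imaginary parts, so a nonnegative one is real. This
    carries norms from [R[i]] to [R], where [sup] and [inf] are taken. *)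
Lemma ge0_Re_complex (c : C) : 0 <= c -> c = (complex.Re c)%:C%C.
Proof. by case: c => a b; rewrite lecE /= => /andP[/eqP-> _]. Qed.

Lemma Re_norm_ge0 (c : C) : 0 <= complex.Re `|c|.
Proof. by rewrite -lecR -ge0_Re_complex ?normr_ge0 //; apply: normr_ge0. Qed.

Lemma normr_rnorm x : `|x| = (rnorm x)%:C%C.
Proof. exact: (ge0_Re_complex _ (normr_ge0 x)). Qed.

Lemma rnorm_ge0 x : 0 <= rnorm x.
Proof. by rewrite -lecR -normr_rnorm; apply: normr_ge0. Qed.

Lemma rnorm_eq0 x : rnorm x = 0 -> x = 0.
Proof. by move=> x0; apply/eqP; rewrite -normr_eq0 normr_rnorm x0. Qed.

Lemma rnormZ (c : C) x : rnorm (c *: x) = complex.Re `|c| * rnorm x.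
Proof.
apply/complexI; rewrite rmorphM /= -!normr_rnorm normrZ.
by rewrite [in LHS](ge0_Re_complex _ (normr_ge0 c)).
Qed.

Lemma rnorm_normalize x : x <> 0 -> rnorm (((rnorm x)^-1)%:C%C *: x) = 1.
Proof.
move=> x0; have nx : rnorm x != 0 by apply/eqP => /rnorm_eq0.
rewrite rnormZ ger0_norm /= ?mulVf //.
by rewrite lecR invr_ge0 rnorm_ge0.
Qed.

(** Cauchy-Schwarz: subtracting from [z] its projection onto [x] leaves a vector of squared norm
    [|z|^2 - |<z, x>|^2]. *)
Lemma inner_norm_le x z : `|x| = 1 -> `|inner z x| <= `|z|.
Proof.
move=> x1; rewrite -(@ler_pXn2r _ 2) ?nnegrE // -subr_ge0.
have xx : inner x x = 1 by rewrite -normr_inner x1 expr1n.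
have : 0 <= inner (z - inner z x *: x) (z - inner z x *: x) by exact: dnorm_ge0.
rewrite dnormB dnormZ xx linearZr_LR /= normr_inner mulr1 normCK.
by congr (0 <= _); rewrite rmorphM /= conjCK; ring.
Qed.

(* Polarization: the left-hand side is half the difference of the quadratic
   form [<T u, u>] at [u = y + z] and [u = y - z]. *)
Lemma polarization_norm_le T (W : C) y z :
    (forall u, `|inner (T u) u| <= W * `|u| ^+ 2) ->
  `|inner (T y) z + inner (T z) y| <= W * (`|y| ^+ 2 + `|z| ^+ 2).
Proof.
move=> TW.
have := lerD (TW (y + z)) (TW (y - z)); rewrite -mulrDr => le2.
have -> : inner (T y) z + inner (T z) y =
   (inner (T (y + z)) (y + z) - inner (T (y - z)) (y - z)) / 2.
  rewrite !linearD !linearN /= !linearDl !linearNl /=.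
  by field.
(* This is the parallelogram law. *)
have -> : `|y| ^+ 2 + `|z| ^+ 2 = (`|y + z| ^+ 2 + `|y - z| ^+ 2) / 2.
  by rewrite !normr_inner dnormD dnormB; field.
rewrite normrM mulrA normfV (ger0_norm (ler0n _ 2)) ler_pM2r ?invr_gt0 ?ltr0n //.
exact: le_trans (ler_normB _ _) le2.
Qed.

(** Any square root of [|s| / s] works when [s] is nonzero. The square is wanted because, after
    polarization, one cross term carries [c] and the other its conjugate. *)
Lemma exists_phase (s : C) : exists2 c : C, `|c| = 1 & c ^+ 2 * s = `|s|.
Proof.
have [->|s0] := eqVneq s 0; first by exists 1; rewrite ?normr1 // mulr0 normr0.
have ns : `|s| != 0 by rewrite normr_eq0.
exists (sqrtC (`|s| / s)); last by rewrite sqrtCK divfK.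
apply/eqP; rewrite -(@eqrXn2 _ 2) ?normr_ge0 ?ler01 //.
by rewrite -normrX sqrtCK normrM normfV normr_id divff // expr1n.
Qed.

Lemma norm_sqr_inner_sqr_le T (W : C) x :
    (forall u, `|inner (T u) u| <= W * `|u| ^+ 2) -> `|x| = 1 ->
  `|T x| ^+ 2 + `|inner (T (T x)) x| <= 2 * W * `|T x|.
Proof.
move=> TW x1; set a := `|T x|.
(* The argument ends by cancelling a factor [a], so [a = 0] is treated apart. *)
have [Tx0|Tx0] := eqVneq (T x) 0.
  by rewrite /a Tx0 linear0 linear0l !normr0 expr0n addr0 mulr0.
have a0 : 0 < a by rewrite normr_gt0.
have [c c1 cs] := exists_phase (inner (T (T x)) x).
(* Both vectors have norm [a], which turns the right-hand side into [2 * W * a ^+ 2]. *)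
have pol := polarization_norm_le T W (a *: x) (c *: T x) TW.
rewrite !linearZ /= !linearZl_LR !linearZr_LR /= -normr_inner -/a in pol.
rewrite !normrZ c1 x1 mulr1 mul1r normr_id -/a in pol.
have cc : c^* * c = 1 by rewrite mulrC -normCK c1 expr1n.
have aC : a^* = a by apply/conj_Creal/ger0_real/ltW.
(* Since [c^* * c = 1], [c] equals [c^* * c ^+ 2]; factoring out [c^*] rotates the inner product
   onto its modulus. *)
have phase : a * (c^* * a ^+ 2) + c * (a * inner (T (T x)) x) =
    a * c^* * (a ^+ 2 + c ^+ 2 * inner (T (T x)) x).
  by ring: cc.
rewrite aC phase cs !normrM norm_conjC c1 mulr1 normr_id -/a in pol.
rewrite [X in _ * X <= _]ger0_norm ?addr_ge0 ?exprn_ge0 ?normr_ge0 // in pol.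
rewrite -(ler_pM2l a0); apply: le_trans pol _.
by rewrite [leRHS](_ : _ = W * (a ^+ 2 + a ^+ 2)) //; ring.
Qed.

(** Normalize a vector outside the kernel. The result makes [opnorm T] positive and the sets under
    [sup] nonempty. *)
Lemma has_unit_vector T : (T : H -> H) <> (fun=> 0) ->
  exists2 x, rnorm x = 1 & T x <> 0.
Proof.
move=> T0; have [x Tx0] : exists x, T x <> 0.
  apply/not_existsP => T0'; apply: T0; apply/funext => x.
  exact: contrapT (T0' x).
have x0 : x <> 0 by move=> x0; apply: Tx0; rewrite x0 linear0.
exists (((rnorm x)^-1)%:C%C *: x); first exact: rnorm_normalize.
rewrite linearZ /= => /eqP; rewrite scaler_eq0 => /orP[|/eqP //].
by move=> /eqP /complexI /eqP; rewrite invr_eq0 => /eqP /rnorm_eq0.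
Qed.

Lemma opnorm_ge A x : bounded_operator A -> rnorm x = 1 -> rnorm (A x) <= opnorm A.
Proof.
move=> [M AM] x1; apply: ub_le_sup; last by exists x.
by exists M => _ [y /= y1 <-]; rewrite -[M]mulr1 -y1.
Qed.

Lemma Re_norm_inner_le x z : rnorm x = 1 -> complex.Re `|inner z x| <= rnorm z.
Proof.
move=> x1; rewrite -lecR -normr_rnorm -ge0_Re_complex //.
by apply: inner_norm_le; rewrite normr_rnorm x1.
Qed.

(** By Cauchy-Schwarz, a bound for the operator also bounds the set under [sup]. *)
Lemma numerical_radius_ge A x : bounded_operator A -> rnorm x = 1 ->
  complex.Re `|inner (A x) x| <= numerical_radius A.
Proof.
move=> [M AM] x1; apply: ub_le_sup; last by exists x.
exists M => _ [y /= y1 <-]; rewrite -[M]mulr1 -y1.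
exact: le_trans (Re_norm_inner_le _ _ y1) (AM y).
Qed.

(** Both sides scale by [|a|^2] when [x] is scaled by [a], so the bound on unit vectors extends to
    all vectors. *)
Lemma norm_inner_le_numerical_radius T x : bounded_operator T ->
  `|inner (T x) x| <= (numerical_radius T)%:C%C * `|x| ^+ 2.
Proof.
move=> Tb; have [->|/eqP x0] := eqVneq x 0.
  by rewrite linear0 !normr0 expr0n mulr0.
pose a := rnorm x; have a0 : a != 0 by apply/eqP => /rnorm_eq0.
have ax : x = a%:C%C *: (a^-1%:C%C *: x).
  by rewrite scalerA -rmorphM /= divff // scale1r.
have := numerical_radius_ge _ _ Tb (rnorm_normalize _ x0).
rewrite -/a; set u := _ *: x in ax *; rewrite -lecR -ge0_Re_complex // => le_u.
rewrite {1 2}ax [T _]linearZ /= linearZl_LR linearZr_LR /= mulrA -normCK normrM.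
have aC : 0 <= a%:C%C :> C by rewrite lecR rnorm_ge0.
rewrite normrX normr_id mulrC normr_rnorm -/a (ger0_norm aC).
by rewrite ler_wpM2r // exprn_ge0.
Qed.

Lemma rnorm_sqr_inner_sqr_le T x : bounded_operator T -> rnorm x = 1 ->
  rnorm (T x) ^+ 2 + complex.Re `|inner (T (T x)) x|
    <= 2 * numerical_radius T * opnorm T.
Proof.
move=> Tb x1.
(* Nonnegativity of the numerical radius allows [rnorm (T x)] to be enlarged to [opnorm T] on the
   right. *)
have w0 : 0 <= numerical_radius T.
  apply: le_trans (numerical_radius_ge _ _ Tb x1).
  exact: Re_norm_ge0.
apply: le_trans (_ : 2 * numerical_radius T * rnorm (T x) <= _); last first.
  by rewrite ler_wpM2l ?mulr_ge0 // opnorm_ge.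
have x1C : `|x| = 1 by rewrite normr_rnorm x1.
have := norm_sqr_inner_sqr_le T _ x
  (fun u => norm_inner_le_numerical_radius T u Tb) x1C.
rewrite normr_rnorm [X in _ + X]ge0_Re_complex // -lecR.
by rewrite rmorphD rmorphXn !rmorphM /= rmorph_nat.
Qed.

Lemma crawford_number_le A x : rnorm x = 1 ->
  crawford_number A <= complex.Re `|inner (A x) x|.
Proof.
move=> x1; apply: ge_inf; last by exists x.
by exists 0 => _ [y _ <-]; exact: Re_norm_ge0.
Qed.

Lemma minimum_norm_le A x : rnorm x = 1 -> 0 <= minimum_norm A <= rnorm (A x).
Proof.
move=> x1; apply/andP; split.
  apply: lb_le_inf; first by exists (rnorm (A x)), x.
  by move=> _ [y _ <-]; exact: rnorm_ge0.
apply: ge_inf; last by exists x.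
by exists 0 => _ [y _ <-]; exact: rnorm_ge0.
Qed.

End HilbertOperators.

Theorem theorem2p8 (R : realType) (H : hilbertType R) (T : {linear H -> H})
    (T_bounded : bounded_operator T) (T_neq0 : (T : H -> H) <> (fun=> 0)) :
  opnorm T / 2 + crawford_number (T \o T) / (2 * opnorm T)
    <= numerical_radius T /\
  minimum_norm T ^+ 2 / (2 * opnorm T)
      + numerical_radius (T \o T) / (2 * opnorm T)
    <= numerical_radius T.
Proof.
have [x x1 Tx0] := has_unit_vector T T_neq0.
have N0 : 0 < opnorm T.
  apply: lt_le_trans (opnorm_ge T x T_bounded x1).
  by rewrite lt_def rnorm_ge0 andbT; apply/eqP => /rnorm_eq0.
set N := opnorm T in N0 *; set w := numerical_radius T.
have key y := rnorm_sqr_inner_sqr_le T y T_bounded.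
rewrite -/N -/w in key.
split.
  set m := crawford_number _.
  have mle y : rnorm y = 1 -> rnorm (T y) ^+ 2 <= 2 * w * N - m.
    move=> y1; rewrite lerBrDr; apply: le_trans (key y y1).
    by rewrite lerD2l (crawford_number_le (T \o T)).
  (* The supremum defines [N], not its square, so each [rnorm (T y)] is compared with the square
     root of [2 * w * N - m], which is nonnegative by [B0]. *)
  have N2 : N ^+ 2 <= 2 * w * N - m.
    have B0 : 0 <= 2 * w * N - m := le_trans (sqr_ge0 _) (mle x x1).
    rewrite -[leRHS]sqr_sqrtr // ler_pXn2r ?nnegrE ?(ltW N0) ?sqrtr_ge0 //.
    apply: ge_sup; first by exists (rnorm (T x)), x.
    move=> _ [y /= y1 <-].
    by rewrite -(ger0_norm (rnorm_ge0 (T y))) -sqrtr_sqr ler_wsqrtr ?mle.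
  have -> : N / 2 + m / (2 * N) = (N ^+ 2 + m) / (2 * N).
    by field; rewrite lt0r_neq0.
  by rewrite ler_pdivrMr ?mulr_gt0 //; lra.
(* With denominators cleared, it remains to bound each value under the supremum for [T \o T] by
   [w * (2 * N) - minimum_norm T ^+ 2]. *)
rewrite -mulrDl ler_pdivrMr ?mulr_gt0 // -lerBrDl.
apply: ge_sup; first by exists (complex.Re `|inner (T (T x)) x|), x.
move=> _ [y /= y1 <-]; rewrite lerBrDl.
have /andP[c0 cle] := minimum_norm_le T y y1.
(* Squaring preserves the inequality because [minimum_norm T] is nonnegative. *)
have := key y y1; have : minimum_norm T ^+ 2 <= rnorm (T y) ^+ 2.
  by rewrite ler_pXn2r ?nnegrE ?rnorm_ge0.
rewrite /= => cT le2; lra.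
Qed.
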